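(* Let $K$ be a field, $S=K[x_1,\ldots,x_n]$, and let $I\subset S$ be a monomial ideal. If $I$ has linear quotients, then its squarefree part $I^*$ has linear quotients.
   Context: For a monomial ideal $I$, $G(I)$ denotes its unique minimal set of monomial generators. $I$ has linear quotients if there is an ordering $u_1,\ldots,u_m$ of $G(I)$ such that for each $i=2,\ldots,m$ the colon ideal $(u_1,\ldots,u_{i-1}):u_i$ is generated by a subset of the variables $\{x_1,\ldots,x_n\}$. (The zero ideal has linear quotients vacuously.) The squarefree part $I^*$ of $I$ is the monomial ideal generated by the squarefree monomials in $I$; equivalently $I^*=(u : u\in G(I)\text{ and } u\text{ is squarefree})$. *)

(* Defs.v *)
From mathcomp Require Import all_boot all_algebra.
From mathcomp Require Import classical_sets.
From mathcomp Require Import mpoly.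

Set Implicit Arguments.
Unset Strict Implicit.
Unset Printing Implicit Defensive.

Local Open Scope ring_scope.
Local Open Scope classical_set_scope.

Section MonomialIdeals.
Variables (K : fieldType) (n : nat).
Implicit Types (I J : set {mpoly K[n]}) (A B : set 'X_{1..n}).

(* MathComp's [idealr_closed] only covers proper ideals; here the unit ideal is
   allowed. *)
Definition is_ideal I : Prop :=
  [/\ I 0,
      forall f g, I f -> I g -> I (f + g)
    & forall a f, I f -> I (a * f)].

Definition ideal_gen (F : set {mpoly K[n]}) : set {mpoly K[n]} :=
  smallest is_ideal F.

Definition colon_ideal J (f : {mpoly K[n]}) : set {mpoly K[n]} :=
  [set g | J (g * f)].

(* Monomials are represented by their exponent vectors. *)
Definition mon_ideal A : set {mpoly K[n]} :=
  ideal_gen [set 'X_[m] | m in A].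

Definition is_monomial_ideal I : Prop := exists A, I = mon_ideal A.

(* [A] is G(I): a set of monomials generating [I], no proper subset of which
   generates [I]. *)
Definition min_mon_gens I A : Prop :=
  mon_ideal A = I /\ (forall B, B `<=` A -> mon_ideal B = I -> B = A).

(* The sequence [u] is u_1, ..., u_m with indices shifted down by one, so
   [take i u] lists the generators preceding [nth 0%MM u i]. *)
Definition has_linear_quotients I : Prop :=
  exists u : seq 'X_{1..n},
    [/\ uniq u,
        min_mon_gens I [set` u]
      & forall i, (0 < i < size u)%N ->
          exists V : set 'I_n,
            colon_ideal (mon_ideal [set` take i u]) 'X_[nth 0%MM u i]
            = ideal_gen [set 'X_j | j in V]].

Definition squarefree_mon (m : 'X_{1..n}) : Prop := forall i, (m i <= 1)%N.

Definition squarefree_part I : set {mpoly K[n]} :=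
  mon_ideal [set m | squarefree_mon m /\ I 'X_[m]].

End MonomialIdeals.

(* Main.v *)
Require Import Defs.
From mathcomp Require Import all_boot all_algebra.
From mathcomp Require Import classical_sets.
From mathcomp Require Import mpoly.

(** Membership in a monomial ideal only depends on divisibility in the support,
    so linear quotients become a condition on exponent vectors: each generator
    [a] preceding [w] has an exponent exceeding that of [w] at some variable
    [j] of [V], and each [j] in [V] satisfies [a <= w + U_(j)] for some
    preceding [a]. Ordering the squarefree generators as in [I], it suffices to
    shrink [V] to the variables not dividing [w]: a squarefree [a] can exceed
    [w] only there, and for such [j] the monomial [w + U_(j)] is squarefree, so
    that its divisor [a] is a squarefree generator. *)

(** Matches a position of the filtered list with one of [s], so that a condition on the prefixes of
    [s] can be applied. In the induction [k] advances at every entry, [i] only at kept ones. *)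
Lemma take_filter (T : Type) (x0 : T) (p : pred T) (s : seq T) (i : nat) :
  (i < size (filter p s))%N ->
  exists k, [/\ (k < size s)%N, nth x0 s k = nth x0 (filter p s) i
               & take i (filter p s) = filter p (take k s)].
Proof.
elim: s i => [|x s IHs] i //=; case: (boolP (p x)) => px /=; last first.
  by move=> /IHs[k [lt_k Ek Et]]; exists k.+1; rewrite /= (negPf px).
case: i => [|i] /=; first by exists 0%N.
by rewrite ltnS => /IHs[k [lt_k Ek Et]]; exists k.+1; rewrite /= px Et.
Qed.

Section MonomialIdeals.

Local Open Scope classical_set_scope.

Variables (K : fieldType) (n : nat).
Implicit Types (A B : set 'X_{1..n}) (a b m w : 'X_{1..n}) (V : set 'I_n).

Lemma ideal_gen_is_ideal (F : set {mpoly K[n]}) : is_ideal (ideal_gen F).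
Proof.
split=> [J HJ|f g Hf Hg J HJ|a f Hf J HJ].
- by have [[J0 _ _] _] := HJ.
- by have [[_ addJ _] _] := HJ; exact: addJ (Hf J HJ) (Hg J HJ).
- by have [[_ _ mulJ] _] := HJ; exact: mulJ (Hf J HJ).
Qed.

(** The polynomials satisfying the support condition form an ideal containing the generators;
    conversely, such a polynomial is a sum of terms, each a multiple of a generator. *)
Lemma mon_idealP A (f : {mpoly K[n]}) :
  mon_ideal A f <->
  forall m, m \in msupp f -> exists2 a, A a & (a <= m)%MM.
Proof.
split=> [|Hf].
  apply: (@smallest_sub _ _ _
    [set g : {mpoly K[n]} |
       forall m, m \in msupp g -> exists2 a, A a & (a <= m)%MM]).
    split=> [m|g h Hg Hh m|g h Hh m] /=; first by rewrite msupp0.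
      by move/msuppD_le; rewrite mem_cat => /orP[/Hg|/Hh].
    move/msuppM_le/allpairsP => [[m1 m2] /= [_ /Hh[a Aa le_a] ->]].
    exists a => //; apply/mnm_lepP => i; rewrite mnmDE.
    by rewrite (leq_trans (mnm_lepP le_a i)) ?leq_addl.
  move=> _ [a Aa <-] m /=; rewrite msuppX inE => /eqP->.
  by exists a => //; exact: lepm_refl.
have [I0 addI mulI] : is_ideal (mon_ideal A : set {mpoly K[n]}).
  exact: ideal_gen_is_ideal.
rewrite (mpolyE f); elim: (msupp f) Hf => [|m s IHs] Hs.
  by rewrite big_nil.
rewrite big_cons; apply: addI; last first.
  by apply: IHs => m' ms'; apply: Hs; rewrite inE ms' orbT.
have [a Aa le_am] := Hs m (mem_head _ _).
rewrite -(submK le_am) mpolyXD -mul_mpolyC.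
apply: (mulI _ _ (mulI _ _ _)).
by apply: sub_gen_smallest; exists a.
Qed.

Lemma mon_idealX A m :
  mon_ideal A ('X_[m] : {mpoly K[n]}) <-> exists2 a, A a & (a <= m)%MM.
Proof.
rewrite mon_idealP; split=> [|Ha m']; first by apply; rewrite msuppX mem_head.
by rewrite msuppX inE => /eqP->.
Qed.

Lemma mon_ideal_sub A B :
  (mon_ideal A : set {mpoly K[n]}) `<=` mon_ideal B <->
  forall a, A a -> exists2 b, B b & (b <= a)%MM.
Proof.
split=> [sAB a Aa|Hab f /mon_idealP Hf].
  apply/mon_idealX; apply: sAB; apply/mon_idealX.
  by exists a => //; exact: lepm_refl.
apply/mon_idealP => m /Hf[a /Hab[b Bb le_ba] le_am].
by exists b => //; exact: lepm_trans le_ba le_am.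
Qed.

(** Minimality means being an antichain for divisibility: a generator divisible by another one can
    be deleted, and in an antichain the divisor in [B] of any [a] in [A] must be [a] itself. *)
Lemma min_mon_gensP (I : set {mpoly K[n]}) A :
  min_mon_gens I A <->
  mon_ideal A = I /\ forall a b, A a -> A b -> (b <= a)%MM -> b = a.
Proof.
split=> -[genA minA]; split=> //.
  move=> a b Aa Ab le_ba; case: (eqVneq b a) => // /eqP neq_ba.
  suff [_ []] : (A `\ a) a by [].
  rewrite (minA (A `\ a)) //.
  rewrite -genA; apply/seteqP; split; apply/mon_ideal_sub => c Ac.
    by exists c; [case: Ac|exact: lepm_refl].
  case: (eqVneq c a) => [->|/eqP neq_ca]; first by exists b.
  by exists c => //; exact: lepm_refl.
move=> B sBA genB; apply/seteqP; split=> // a Aa.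
have : mon_ideal A `<=` (mon_ideal B : set {mpoly K[n]}) by rewrite genA genB.
case/mon_ideal_sub/(_ a Aa) => b Bb le_ba.
by rewrite -(minA a b) //; exact: sBA.
Qed.

(** Subtraction is truncated, so [a - w] is the exponent of [a / gcd(a, w)]; it divides [m] exactly
    when [a] divides [w + m]. *)
Lemma colon_mon_idealX A w :
  colon_ideal (mon_ideal A) ('X_[w] : {mpoly K[n]}) =
  mon_ideal [set (a - w)%MM | a in A].
Proof.
apply/seteqP; split=> f.
  move=> /mon_idealP Hf; apply/mon_idealP => m mf.
  have [|a Aa le_a] := Hf (w + m)%MM.
    by rewrite (perm_mem (msuppMX _ _)) map_f.
  exists (a - w)%MM; first by exists a.
  by apply/mnm_lepP => i; rewrite mnmBE leq_subLR -mnmDE; exact: mnm_lepP.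
move=> /mon_idealP Hf; apply/mon_idealP => m.
rewrite (perm_mem (msuppMX _ _)) => /mapP[m' /Hf[_ [a Aa <-] le_a] ->].
exists a => //; apply/mnm_lepP => i.
by rewrite mnmDE -leq_subLR -mnmBE; exact: mnm_lepP.
Qed.

Lemma colon_linearP A w V :
  colon_ideal (mon_ideal A) ('X_[w] : {mpoly K[n]}) =
    ideal_gen [set 'X_j | j in V] <->
  (forall a, A a -> exists2 j, V j & (w j < a j)%N) /\
  (forall j, V j -> exists2 a, A a & (a <= w + U_(j))%MM).
Proof.
have le_UE j m : (U_(j) <= m)%MM = (0 < m j)%N.
  apply/mnm_lepP/idP => [/(_ j)|m_gt0 i]; first by rewrite mnm1E eqxx.
  by rewrite mnm1E; case: eqP => [<-|].
have le_subE a m : ((a - w)%MM <= m)%MM = (a <= w + m)%MM.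
  by apply/mnm_lepP/mnm_lepP => H i; have := H i; rewrite mnmBE mnmDE leq_subLR.
(* The variable ['X_j] is the monomial with exponent [U_(j)], so both sides are monomial ideals and
   can be compared generator by generator. *)
have -> : [set ('X_j : {mpoly K[n]}) | j in V] =
          [set 'X_[m] | m in [set U_(j)%MM | j in V]].
  by rewrite -image_comp.
rewrite colon_mon_idealX -/(mon_ideal _); split=> [E|[Hsub Hsup]].
  move/seteqP: E => [/mon_ideal_sub Hsub /mon_ideal_sub Hsup].
  split=> [a Aa|j Vj].
    have [|_ [j Vj <-]] := Hsub (a - w)%MM; first by exists a.
    by rewrite le_UE mnmBE subn_gt0; exists j.
  have [|_ [a Aa <-]] := Hsup U_(j)%MM; first by exists j.
  by rewrite le_subE; exists a.
apply/seteqP; split; apply/mon_ideal_sub => _ [c cP <-].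
  have [j Vj lt_j] := Hsub c cP; exists U_(j)%MM; first by exists j.
  by rewrite le_UE mnmBE subn_gt0.
have [a Aa le_a] := Hsup c cP; exists (a - w)%MM; first by exists a.
by rewrite le_subE.
Qed.

Definition sqfreeb m : bool := [forall i, (m i <= 1)%N].

Lemma sqfreebP m : reflect (squarefree_mon m) (sqfreeb m).
Proof. exact: forallP. Qed.

Lemma squarefree_dvd a m : (a <= m)%MM -> squarefree_mon m -> squarefree_mon a.
Proof. by move=> /mnm_lepP le_am sm i; exact: leq_trans (sm i). Qed.

(** A squarefree monomial of [I] is divisible by a generator, which is then squarefree too; a subset
    of an antichain is an antichain. *)
Lemma min_mon_gens_squarefree (I : set {mpoly K[n]}) (u : seq 'X_{1..n}) :
  min_mon_gens I [set` u] ->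
  min_mon_gens (squarefree_part I) [set` filter sqfreeb u].
Proof.
move=> /min_mon_gensP[genI minI]; apply/min_mon_gensP; split; last first.
  move=> a b /=; rewrite !mem_filter => /andP[_ ua] /andP[_ ub].
  exact: minI.
rewrite -genI; apply/seteqP; split; apply/mon_ideal_sub => a /=.
  rewrite mem_filter => /andP[/sqfreebP sa ua].
  exists a; last exact: lepm_refl.
  by split=> //; apply/mon_idealX; exists a => //; exact: lepm_refl.
move=> [sa /mon_idealX[b ub le_ba]]; exists b => //=.
by rewrite mem_filter ub andbT; apply/sqfreebP/(squarefree_dvd _ _ le_ba).
Qed.

Lemma colon_linear_squarefree (s : seq 'X_{1..n}) w V :
  squarefree_mon w ->
  colon_ideal (mon_ideal [set` s]) ('X_[w] : {mpoly K[n]}) =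
    ideal_gen [set 'X_j | j in V] ->
  colon_ideal (mon_ideal [set` filter sqfreeb s]) ('X_[w] : {mpoly K[n]}) =
    ideal_gen [set 'X_j | j in V `&` [set j | w j = 0%N]].
Proof.
move=> sw /colon_linearP[Hsub Hsup]; apply/colon_linearP; split=> [a|j].
  rewrite /= mem_filter => /andP[/sqfreebP sa /Hsub[j Vj lt_j]].
  (* Here [w j < a j <= 1], which forces [w j = 0]. *)
  exists j => //; split=> //=; apply/eqP; rewrite -leqn0 -ltnS.
  exact: leq_trans lt_j (sa j).
move=> [/Hsup[a sa le_a] /= wj0]; exists a => //=; rewrite mem_filter sa andbT.
(* The exponent of [w + U_(j)] is 1 at [j], since [w j = 0], and that of [w] elsewhere. *)
apply/sqfreebP/(squarefree_dvd _ _ le_a) => i; rewrite mnmDE mnm1E.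
by case: eqP => [<-|_]; rewrite ?wj0 // addn0.
Qed.

End MonomialIdeals.

Theorem proposition2p10 (K : fieldType) (n : nat) (I : set {mpoly K[n]}) :
  is_monomial_ideal I -> has_linear_quotients I ->
  has_linear_quotients (squarefree_part I).
Proof.
move=> _ [u [uniq_u genI linI]]; exists (filter (@sqfreeb n) u).
split=> [||i /andP[i_gt0 lt_i]].
- exact: filter_uniq.
- exact: min_mon_gens_squarefree.
have [k [lt_k Ek Et]] := take_filter _ 0%MM _ _ _ lt_i.
(* The hypothesis [linI] covers positive positions only; [k = 0] would make the prefix of length
   [i > 0] empty. *)
have k_gt0 : (0 < k)%N.
  case: k Et {lt_k Ek} => // /(congr1 size).
  by rewrite take0 size_takel ?(ltnW lt_i) //= => i0; rewrite i0 in i_gt0.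
have [|V linV] := linI k; first by rewrite k_gt0.
rewrite -Ek Et; eexists; apply: colon_linear_squarefree linV.
rewrite Ek; apply/sqfreebP.
by have := mem_nth 0%MM lt_i; rewrite mem_filter => /andP[].
Qed.
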